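(* Let $\mathcal{D}$ be the finitely supported distribution monad on $\mathbf{Set}$. Let $\Sigma^{\mathrm{s}}_{\mathcal{D}}=\{\mathsf{a}:1,\ +_p:2\mid p\in(0,1)\}$ (one unary operation symbol and a binary operation symbol $+_p$ for each $p\in(0,1)$) and let $E^{\mathrm{s}}_{\mathcal{D}}$ contain the equations, for all $p,q\in(0,1)$, \begin{align*} \mathsf{a}\mathsf{a}x&=\mathsf{a}x,\\ \mathsf{a}(x+_py)&=x+_py,\\ \mathsf{a}x+_p\mathsf{a}y&=x+_py,\\ x+_px&=\mathsf{a}x,\\ x+_py&=y+_{1-p}x,\\ (x+_qy)+_pz&=x+_{pq}\bigl(y+_{\frac{p(1-q)}{1-pq}}z\bigr). \end{align*} Then there is an isomorphism of categories $\mathbf{A}(\Sigma^{\mathrm{s}}_{\mathcal{D}},E^{\mathrm{s}}_{\mathcal{D}})\cong\mathrm{EM}_{\mathrm{s}}(\mathcal{D})$.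
   Context: $\mathcal{D}X=\{\varphi\in[0,1]^X\mid\sum_{x\in X}\varphi(x)=1,\ \varphi(x)\neq0\text{ for only finitely many }x\}$, acting on maps by pushforward. The unit sends $x$ to the Dirac distribution $1x$ at $x$, and the multiplication is $\mu_X(\Phi)(x)=\sum_{\phi\in\mathrm{supp}(\Phi)}\Phi(\phi)\cdot\phi(x)$. For a monad $(M,\eta,\mu)$, an $M$-semialgebra is a pair $(X,x)$ with $x:MX\to X$ satisfying $x\circ Mx=x\circ\mu_X$ (no unit axiom). A homomorphism $(X,x)\to(Y,y)$ is $h:X\to Y$ with $h\circ x=y\circ Mh$. $\mathrm{EM}_{\mathrm{s}}(M)$ is the resulting category. For an algebraic theory $(\Sigma,E)$ (a signature of finitary operation symbols, written $f:n$ for arity $n$, and a set of equations between $\Sigma$-terms), $\mathbf{A}(\Sigma,E)$ is the category of $(\Sigma,E)$-algebras (sets with an operation $A^n\to A$ for each $f:n\in\Sigma$ satisfying all the equations in $E$) and operation-preserving maps. Here $E^{\mathrm{s}}_{\mathcal{D}}$ consists of exactly the listed equations. *)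

(* Defs.v *)
From mathcomp Require Import all_boot all_order all_algebra.
From mathcomp Require Import finmap boolp classical_sets functions cardinality fsbigop.
From mathcomp Require Import reals.
Set Implicit Arguments.
Unset Strict Implicit.
Unset Printing Implicit Defensive.
Import Order.TTheory GRing.Theory Num.Theory.
Local Open Scope classical_set_scope.
Local Open Scope ring_scope.

Record category := Category {
  Ob :> Type;
  Hom : Ob -> Ob -> Type;
  idm : forall a, Hom a a;
  compm : forall a b c, Hom b c -> Hom a b -> Hom a c;
  comp1m : forall a b (f : Hom a b), compm (idm b) f = f;
  compm1 : forall a b (f : Hom a b), compm f (idm a) = f;
  compmA : forall a b c d (h : Hom c d) (g : Hom b c) (f : Hom a b),
    compm h (compm g f) = compm (compm h g) f }.

Record functor (C D : category) := Functor {
  fob :> C -> D;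
  fhom : forall a b : C, Hom a b -> Hom (fob a) (fob b);
  fhom1 : forall a, fhom (idm a) = idm (fob a);
  fhomM : forall (a b c : C) (g : Hom b c) (f : Hom a b),
    fhom (compm g f) = compm (fhom g) (fhom f) }.

Definition functor_id (C : category) : functor C C :=
  @Functor C C (fun a => a) (fun a b f => f)
    (fun a => erefl) (fun a b c g f => erefl).

Section FunctorComp.
Variables (C D E : category) (G : functor D E) (F : functor C D).

Lemma functor_comp_id (a : C) : fhom G (fhom F (idm a)) = idm (G (F a)).
Proof. by rewrite !fhom1. Qed.

Lemma functor_comp_comp (a b c : C) (g : Hom b c) (f : Hom a b) :
  fhom G (fhom F (compm g f)) = compm (fhom G (fhom F g)) (fhom G (fhom F f)).
Proof. by rewrite !fhomM. Qed.

Definition functor_comp : functor C E :=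
  @Functor C E (fun a => G (F a)) (fun a b f => fhom G (fhom F f))
    functor_comp_id functor_comp_comp.
End FunctorComp.

(* Isomorphism, not equivalence: the composites are equal (as functors, on
   objects and on morphisms) to the identities. *)
Definition isomorphic (C D : category) : Prop :=
  exists (F : functor C D) (G : functor D C),
    functor_comp G F = functor_id C /\ functor_comp F G = functor_id D.

(* A monad on Set, sets being types: under the axioms of [boolp], equality of
   functions is extensional and all proofs of an equality are equal. *)
Record monad := Monad {
  mob :> Type -> Type;
  mmap : forall X Y : Type, (X -> Y) -> mob X -> mob Y;
  munit : forall X : Type, X -> mob X;
  mmul : forall X : Type, mob (mob X) -> mob X;
  mmap_id : forall X (t : mob X), mmap id t = t;
  mmap_comp : forall X Y Z (g : Y -> Z) (f : X -> Y) (t : mob X),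
    mmap (g \o f) t = mmap g (mmap f t);
  munit_nat : forall X Y (f : X -> Y) (x : X),
    mmap f (munit x) = munit (f x);
  mmul_nat : forall X Y (f : X -> Y) (t : mob (mob X)),
    mmap f (mmul t) = mmul (mmap (mmap f) t);
  mmul_unit : forall X (t : mob X), mmul (munit t) = t;
  mmul_map_unit : forall X (t : mob X), mmul (mmap (@munit X) t) = t;
  mmul_mul : forall X (t : mob (mob (mob X))),
    mmul (mmul t) = mmul (mmap (@mmul X) t) }.

Section Semialgebra.
Variable M : monad.

(* There is no unit axiom: [sastr (munit _ x)] need not be [x]. *)
Record semialgebra := Semialgebra {
  sacar :> Type;
  sastr : M sacar -> sacar;
  sastrP : forall t : M (M sacar), sastr (mmap sastr t) = sastr (mmul t) }.

Record semialgebra_hom (X Y : semialgebra) := SemialgebraHom {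
  sahom :> X -> Y;
  sahomP : forall t : M X, sahom (sastr t) = sastr (mmap sahom t) }.

Lemma semialgebra_hom_eq (X Y : semialgebra) (h k : semialgebra_hom X Y) :
  h =1 k -> h = k.
Proof.
case: h k => [h hP] [k kP] /= /funext hk; move: hP kP; rewrite hk => hP kP.
by congr SemialgebraHom; exact: Prop_irrelevance.
Qed.

Lemma sahom_id_subproof (X : semialgebra) (t : M X) :
  id (sastr t) = sastr (mmap id t).
Proof. by rewrite mmap_id. Qed.

Lemma sahom_comp_subproof (X Y Z : semialgebra) (g : semialgebra_hom Y Z)
    (f : semialgebra_hom X Y) (t : M X) :
  (g \o f) (sastr t) = sastr (mmap (g \o f) t).
Proof. by rewrite mmap_comp -!sahomP. Qed.

Definition EMs : category.
Proof.
apply: (@Category semialgebra semialgebra_hom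
  (fun X => SemialgebraHom (@sahom_id_subproof X))
  (fun X Y Z g f => SemialgebraHom (sahom_comp_subproof g f)));
by move=> *; exact: semialgebra_hom_eq.
Defined.
End Semialgebra.

Record signature := Signature {
  opsym : Type;
  arity : opsym -> nat }.

(* Terms over countably many variables, which suffices for finitary terms; the
   arguments of an n-ary symbol form a function from 'I_n. *)
Inductive term (S : signature) : Type :=
  | Var of nat
  | App (f : opsym S) of ('I_(arity f) -> term S).
Arguments Var {S} _.
Arguments App {S} f _.

Record theory := Theory {
  sig :> signature;
  equations : set (term sig * term sig) }.

Section Algebra.
Variable T : theory.

Fixpoint eval (A : Type)
    (op : forall f : opsym T, ('I_(arity f) -> A) -> A)
    (v : nat -> A) (t : term T) : A :=
  match t with
  | Var i => v i
  | App f args => op f (fun i => eval op v (args i))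
  end.

Record algebra := Algebra {
  acar :> Type;
  aop : forall f : opsym T, ('I_(arity f) -> acar) -> acar;
  aopP : forall s t : term T, equations (s, t) ->
    forall v : nat -> acar, eval aop v s = eval aop v t }.

Record algebra_hom (A B : algebra) := AlgebraHom {
  ahom :> A -> B;
  ahomP : forall (f : opsym T) (args : 'I_(arity f) -> A),
    ahom (aop args) = aop (ahom \o args) }.

Lemma algebra_hom_eq (A B : algebra) (h k : algebra_hom A B) :
  h =1 k -> h = k.
Proof.
case: h k => [h hP] [k kP] /= /funext hk; move: hP kP; rewrite hk => hP kP.
by congr AlgebraHom; exact: Prop_irrelevance.
Qed.

Lemma ahom_id_subproof (A : algebra) (f : opsym T) (args : 'I_(arity f) -> A) :
  id (aop args) = aop (id \o args).
Proof. by []. Qed.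

Lemma ahom_comp_subproof (A B C : algebra) (g : algebra_hom B C)
    (h : algebra_hom A B) (f : opsym T) (args : 'I_(arity f) -> A) :
  (g \o h) (aop args) = aop ((g \o h) \o args).
Proof. by rewrite /= !ahomP. Qed.

Definition Alg : category.
Proof.
apply: (@Category algebra algebra_hom
  (fun A => AlgebraHom (@ahom_id_subproof A))
  (fun A B C g h => AlgebraHom (ahom_comp_subproof g h)));
by move=> *; exact: algebra_hom_eq.
Defined.
End Algebra.

Section Dist.
Variable R : realType.

(* {classic X} is X itself, with the classical choiceType structure required by
   the finitely supported sums of [fsbigop]. *)
Definition supp (X : Type) (p : X -> R) : set {classic X} :=
  [set x | p x != 0].

Record dist (X : Type) := Dist {
  pmf :> X -> R;
  pmf_itv : forall x, 0 <= pmf x <= 1;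
  pmf_fin : finite_set (supp pmf);
  pmf_sum : \sum_(x \in supp pmf) pmf x = 1 }.

Lemma dist_eq (X : Type) (p q : dist X) : p =1 q -> p = q.
Proof.
case: p q => [p p1 p2 p3] [q q1 q2 q3] /= /funext pq.
move: p1 p2 p3 q1 q2 q3; rewrite pq => p1 p2 p3 q1 q2 q3.
by congr Dist; exact: Prop_irrelevance.
Qed.

Definition dirac_pmf (X : Type) (x : X) : X -> R :=
  fun y => (`[< y = x >])%:R.

Definition map_pmf (X Y : Type) (f : X -> Y) (p : X -> R) : Y -> R :=
  fun y => \sum_(x \in supp p `&` [set x : {classic X} | f x = y]) p x.

Definition mul_pmf (X : Type) (P : dist X -> R) : X -> R :=
  fun x => \sum_(q \in supp P) P q * (q : dist X) x.

(* [bind_pmf] and the expectation [expect] are only used to establish the monad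
   laws. *)
Definition bind_pmf (X Y : Type) (p : X -> R) (k : X -> Y -> R) : Y -> R :=
  fun y => \sum_(x \in supp p) p x * k x y.

Definition expect (X : Type) (p : X -> R) (g : X -> R) : R :=
  \sum_(x \in supp p) p x * g x.

Lemma expect_fset (X : Type) (U : set {classic X}) (p g : X -> R) :
  finite_set U -> supp p `<=` U ->
  expect p g = \sum_(x <- fset_set U) p x * g x.
Proof.
move=> fU pU; rewrite /expect -fsbig_finite //.
apply: fsbig_widen => // x [_] /= /negP.
by rewrite negbK => /eqP ->; rewrite mul0r.
Qed.

Lemma expect1 (X : Type) (p : X -> R) :
  \sum_(x \in supp p) p x = expect p (fun=> 1).
Proof. by apply: eq_fsbigr => x _; rewrite mulr1. Qed.

Lemma eq_expect (X : Type) (p g h : X -> R) :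
  (forall x, p x != 0 -> g x = h x) -> expect p g = expect p h.
Proof.
by move=> gh; apply: eq_fsbigr => x /set_mem/gh ->.
Qed.

Lemma supp_dirac (X : Type) (x : X) :
  supp (dirac_pmf x) = [set x : {classic X}].
Proof.
apply/seteqP; split => y; rewrite /supp /dirac_pmf /=.
  by case: asboolP => //; rewrite eqxx.
by move=> ->; rewrite asboolT // oner_neq0.
Qed.

Lemma expect_dirac (X : Type) (x : X) (g : X -> R) :
  expect (dirac_pmf x) g = g x.
Proof.
by rewrite /expect supp_dirac fsbig_set1 /dirac_pmf asboolT // mul1r.
Qed.

Lemma pmf_expect (X : Type) (p : X -> R) (x : X) :
  finite_set (supp p) -> p x = expect p (fun y => dirac_pmf x y).
Proof.
move=> fp.
pose U : set {classic X} := supp p `|` [set x : {classic X}].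
have fU : finite_set U by rewrite finite_setU; split; last exact: finite_set1.
rewrite (expect_fset _ fU); last by move=> y py; left.
have xU : (x : {classic X}) \in fset_set U.
  by rewrite in_fset_set //; apply/mem_set; right.
rewrite (bigD1_seq (x : {classic X}) xU (fset_uniq _)) /=.
rewrite {1}/dirac_pmf asboolT // mulr1 big1 ?addr0 // => y /eqP yx.
by rewrite /dirac_pmf asboolF // mulr0.
Qed.

Lemma supp_bind (X Y : Type) (p : X -> R) (k : X -> Y -> R) :
  supp (bind_pmf p k) `<=` \bigcup_(x in supp p) supp (k x).
Proof.
move=> y /=; rewrite /supp /= /bind_pmf => /(@fsbigN1 _ _ _ _ _ _
  (fun (_ : unit) (x : {classic X}) => p x * k x y) tt) [x px pk].
by exists x => //=; apply: contra_neq pk => ->; rewrite mulr0.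
Qed.

Lemma supp_bind_fin (X Y : Type) (p : X -> R) (k : X -> Y -> R) :
  finite_set (supp p) -> (forall x, finite_set (supp (k x))) ->
  finite_set (supp (bind_pmf p k)).
Proof.
move=> fp fk; apply: sub_finite_set (@supp_bind _ _ p k) _.
by apply: bigcup_finite.
Qed.

Lemma expect_bind (X Y : Type) (p : X -> R) (k : X -> Y -> R) (g : Y -> R) :
  finite_set (supp p) -> (forall x, finite_set (supp (k x))) ->
  expect (bind_pmf p k) g = expect p (fun x => expect (k x) g).
Proof.
move=> fp fk.
pose U : set {classic Y} := \bigcup_(x in supp p) supp (k x).
have fU : finite_set U by exact: bigcup_finite.
rewrite (expect_fset _ fU); last exact: supp_bind.
rewrite (expect_fset _ fp) //.
under eq_bigr => y _.
  rewrite /bind_pmf fsbig_finite // big_distrl /=.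
  under eq_bigr do rewrite -mulrA.
  over.
rewrite exchange_big /= big_seq [RHS]big_seq; apply: eq_bigr => x.
rewrite in_fset_set // inE => px.
rewrite (expect_fset _ fU); last by move=> y ky; exists x.
by rewrite big_distrr.
Qed.

Lemma map_pmfE (X Y : Type) (f : X -> Y) (p : X -> R) :
  map_pmf f p = bind_pmf p (fun x => dirac_pmf (f x)).
Proof.
apply/funext => y; rewrite /map_pmf /bind_pmf.
transitivity (\sum_(x \in supp p `&` [set x : {classic X} | f x = y])
    (p x * dirac_pmf (f x) y)).
  apply: eq_fsbigr => x /set_mem[_ /= fxy].
  by rewrite /dirac_pmf asboolT // mulr1.
apply: fsbig_widen => [x []//|x [px npx]] /=.
rewrite /dirac_pmf asboolF ?mulr0 // => yfx.
by apply: npx; split.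
Qed.

Lemma supp_dirac_fin (X : Type) (x : X) : finite_set (supp (dirac_pmf x)).
Proof. by rewrite supp_dirac; exact: finite_set1. Qed.

Lemma dirac_itv (X : Type) (x y : X) : 0 <= dirac_pmf x y <= 1.
Proof. by rewrite /dirac_pmf; case: asboolP; rewrite ?ler01 ?lexx. Qed.

Lemma dirac_sum (X : Type) (x : X) :
  \sum_(y \in supp (dirac_pmf x)) dirac_pmf x y = 1.
Proof. by rewrite expect1 expect_dirac. Qed.

Definition ddirac (X : Type) (x : X) : dist X :=
  Dist (dirac_itv x) (supp_dirac_fin x) (dirac_sum x).

Section BindDist.
Variables (X Y : Type) (p : dist X) (k : X -> dist Y).

Lemma bind_itv y : 0 <= bind_pmf p k y <= 1.
Proof.
have k0 x : 0 <= k x y by case/andP: (pmf_itv (k x) y).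
have p0 x : 0 <= p x by case/andP: (pmf_itv p x).
apply/andP; split; first by apply: fsumr_ge0 => x _; exact: mulr_ge0.
rewrite -(pmf_sum p) /bind_pmf !fsbig_finite; try exact: pmf_fin.
apply: ler_sum => x _.
by apply: ler_piMr => //; case/andP: (pmf_itv (k x) y).
Qed.

Lemma bind_fin : finite_set (supp (bind_pmf p k)).
Proof. by apply: supp_bind_fin => *; exact: pmf_fin. Qed.

Lemma bind_sum : \sum_(y \in supp (bind_pmf p k)) bind_pmf p k y = 1.
Proof.
rewrite expect1 expect_bind; try by move=> *; exact: pmf_fin.
transitivity (expect p (fun=> 1)); last by rewrite -expect1 pmf_sum.
by apply: eq_expect => x _; rewrite -expect1 pmf_sum.
Qed.
End BindDist.

Section MapDist.
Variables (X Y : Type) (f : X -> Y).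

Lemma map_itv (p : dist X) y : 0 <= map_pmf f p y <= 1.
Proof. by rewrite map_pmfE; exact: (bind_itv p (fun x => ddirac (f x))). Qed.

Lemma map_fin (p : dist X) : finite_set (supp (map_pmf f p)).
Proof. by rewrite map_pmfE; exact: (bind_fin p (fun x => ddirac (f x))). Qed.

Lemma map_sum (p : dist X) : \sum_(y \in supp (map_pmf f p)) map_pmf f p y = 1.
Proof. by rewrite map_pmfE; exact: (bind_sum p (fun x => ddirac (f x))). Qed.

Definition dmap (p : dist X) : dist Y :=
  Dist (map_itv p) (map_fin p) (map_sum p).
End MapDist.

Definition dmul (X : Type) (P : dist (dist X)) : dist X :=
  @Dist X (mul_pmf P) (bind_itv P id) (bind_fin P id) (bind_sum P id).

Lemma expect_dmap (X Y : Type) (f : X -> Y) (p : dist X) (g : Y -> R) :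
  expect (dmap f p) g = expect p (g \o f).
Proof.
rewrite /= map_pmfE.
rewrite (expect_bind _ (pmf_fin p) (fun x => supp_dirac_fin (f x))).
by apply: eq_expect => x _; rewrite expect_dirac.
Qed.

Lemma expect_dmul (X : Type) (P : dist (dist X)) (g : X -> R) :
  expect (dmul P) g = expect P (fun q : dist X => expect q g).
Proof. by apply: expect_bind => *; exact: pmf_fin. Qed.

Lemma dist_expect_eq (X : Type) (p q : dist X) :
  (forall g, expect p g = expect q g) -> p = q.
Proof.
move=> pq; apply: dist_eq => x.
by rewrite (pmf_expect x (pmf_fin p)) (pmf_expect x (pmf_fin q)).
Qed.

Definition distribution_monad : monad.
Proof.
apply: (@Monad dist dmap ddirac dmul).
- by move=> X t; apply: dist_expect_eq => g; rewrite expect_dmap.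
- by move=> X Y Z g f t; apply: dist_expect_eq => h; rewrite !expect_dmap.
- move=> X Y f x; apply: dist_expect_eq => h.
  by rewrite expect_dmap !expect_dirac.
- move=> X Y f t; apply: dist_expect_eq => h.
  rewrite expect_dmap !expect_dmul expect_dmap.
  by apply: eq_expect => q _; rewrite /= -expect_dmap.
- move=> X t; apply: dist_expect_eq => h.
  by rewrite expect_dmul expect_dirac.
- move=> X t; apply: dist_expect_eq => h.
  rewrite expect_dmul expect_dmap.
  by apply: eq_expect => q _; rewrite /= expect_dirac.
- move=> X t; apply: dist_expect_eq => h.
  rewrite !expect_dmul expect_dmap.
  by apply: eq_expect => q _; rewrite /= -expect_dmul.
Defined.

Record open_unit := OpenUnit {
  ouval :> R;
  ouvalP : 0 < ouval < 1 }.

Lemma ou_gt0 (p : open_unit) : 0 < p :> R.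
Proof. by case/andP: (ouvalP p). Qed.

Lemma ou_lt1 (p : open_unit) : p < 1 :> R.
Proof. by case/andP: (ouvalP p). Qed.

Lemma ou_onem_subproof (p : open_unit) : 0 < 1 - ouval p < 1.
Proof. by rewrite subr_gt0 ou_lt1 ltrBlDr ltrDl ou_gt0. Qed.

Lemma ou_mul_subproof (p q : open_unit) : 0 < ouval p * ouval q < 1.
Proof.
rewrite mulr_gt0 ?ou_gt0 //=.
by rewrite (lt_trans _ (ou_lt1 q)) // gtr_pMl ?ou_gt0 ?ou_lt1.
Qed.

Lemma ou_assoc_subproof (p q : open_unit) :
  0 < ouval p * (1 - ouval q) / (1 - ouval p * ouval q) < 1.
Proof.
have pq : 0 < 1 - ouval p * ouval q.
  by rewrite subr_gt0; case/andP: (ou_mul_subproof p q).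
rewrite divr_gt0 //=; last by rewrite mulr_gt0 ?ou_gt0 // subr_gt0 ou_lt1.
by rewrite ltr_pdivrMr // mul1r mulrBr mulr1 ltrD2r ou_lt1.
Qed.

(* The indices 1 - p, p q and p (1 - q) / (1 - p q), as elements of (0,1). *)
Definition ou_onem (p : open_unit) := OpenUnit (ou_onem_subproof p).
Definition ou_mul (p q : open_unit) := OpenUnit (ou_mul_subproof p q).
Definition ou_assoc (p q : open_unit) := OpenUnit (ou_assoc_subproof p q).

Inductive convex_opsym :=
  | op_a
  | op_plus of open_unit.

Definition convex_sig : signature :=
  @Signature convex_opsym (fun f => if f is op_plus _ then 2 else 1)%N.

Definition tm_a (t : term convex_sig) : term convex_sig :=
  @App convex_sig op_a (fun=> t).

Definition tm_plus (p : open_unit) (s t : term convex_sig) : term convex_sig :=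
  @App convex_sig (op_plus p) (fun i : 'I_2 => if i == ord0 then s else t).

Local Notation a := tm_a.
Local Notation "s +[ p ] t" := (tm_plus p s t)
  (at level 50, p at next level, left associativity).
Local Notation x := (Var 0).
Local Notation y := (Var 1).
Local Notation z := (Var 2).

Inductive convex_eq : term convex_sig -> term convex_sig -> Prop :=
  | eq_aa : convex_eq (a (a x)) (a x)
  | eq_a_plus p : convex_eq (a (x +[p] y)) (x +[p] y)
  | eq_plus_a p : convex_eq (a x +[p] a y) (x +[p] y)
  | eq_plus_idem p : convex_eq (x +[p] x) (a x)
  | eq_plus_comm p : convex_eq (x +[p] y) (y +[ou_onem p] x)
  | eq_plus_assoc p q : convex_eq ((x +[q] y) +[p] z)
      (x +[ou_mul p q] (y +[ou_assoc p q] z)).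

Definition convex_semitheory : theory :=
  @Theory convex_sig [set e | convex_eq e.1 e.2].

End Dist.

(* Main.v *)
(** Every distribution is built from Dirac distributions by binary mixtures.  A
    semialgebra [s] thus satisfies [s (p phi + (1 - p) psi) = s phi +_p s psi],
    so it is determined by [a x = s (1 x)] and
    [x +_p y = s (p (1 x) + (1 - p) (1 y))], and the equations hold because
    both sides are images of one distribution.  Conversely, given an algebra,
    attach positive weights to its elements: with
    [(r, b) + (s, c) = (r + s, b +_{r/(r+s)} c)] and a zero they form a
    commutative monoid, and [s phi] is the point of the sum of the
    [(phi x, a x)], whose weight is 1.  As [+_p] is idempotent on the image of
    [a], weights distribute over these points, whence [s] preserves mixtures;
    everything else follows by induction on mixtures. *)
From HB Require Import structures.
From mathcomp Require Import all_boot all_order all_algebra.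
From mathcomp Require Import ring lra.
From mathcomp Require Import finmap boolp classical_sets functions cardinality fsbigop.
Require Import Defs.
From mathcomp Require Import reals.
Set Implicit Arguments.
Unset Strict Implicit.
Unset Printing Implicit Defensive.
Import Order.TTheory GRing.Theory Num.Theory.
Local Open Scope classical_set_scope.
Local Open Scope ring_scope.

(** [fhom K f] and [f] have different types until [K a] is identified with [a], so morphisms are
    compared in a sigma type, together with their endpoints. *)
Lemma functor_eq_id (C : category) (K : functor C C) :
  (forall a, K a = a) ->
  (forall (a b : C) (f : Hom a b),
    existT (fun ab : C * C => Hom ab.1 ab.2) (K a, K b) (fhom K f) =
    existT (fun ab : C * C => Hom ab.1 ab.2) (a, b) f) ->
  K = functor_id C.
Proof.
case: K => Ko Kh K1 KM /= /funext Koid; subst Ko => homE.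
have Khid : Kh = fun a b f => f.
  apply: functional_extensionality_dep => a.
  apply: functional_extensionality_dep => b.
  apply/funext => f; move: (projT2_eq (homE a b f)).
  (* [e] is now a loop at [(a, b)], so transport along it is trivial by proof irrelevance. *)
  move: (projT1_eq _) => /= e.
  by rewrite (Prop_irrelevance e erefl).
subst Kh; rewrite /functor_id.
by congr Functor; exact: Prop_irrelevance.
Qed.

(** * Equality of structures on a fixed carrier *)

Section AlgebraEq.
Variable T : theory.

Lemma algebra_eq (A : algebra T)
    (op : forall f : opsym T, ('I_(arity f) -> A) -> A) opP :
  op = @aop T A -> @Algebra T A op opP = A.
Proof.
move=> opE; subst op; case: A opP => A op opP opP' /=.
by congr Algebra; exact: Prop_irrelevance.
Qed.

(** Supplies the morphism hypothesis of [functor_eq_id]: the round trip keeps carriers and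
    underlying maps, so only the operations have to be identified. *)
Lemma algebra_hom_sigT_eq (A B : algebra T) opA PA opB PB (h : algebra_hom A B)
    (h' : algebra_hom (@Algebra T A opA PA) (@Algebra T B opB PB)) :
  opA = @aop T A -> opB = @aop T B -> (h' : A -> B) =1 h ->
  existT (fun AB : algebra T * algebra T => algebra_hom AB.1 AB.2)
    (@Algebra T A opA PA, @Algebra T B opB PB) h' = existT _ (A, B) h.
Proof.
move=> EA EB; subst opA opB; case: A B PA PB h h' => A oA oAP [B oB oBP] /=.
move=> PA PB h h'.
have EA := Prop_irrelevance PA oAP; subst PA.
have EB := Prop_irrelevance PB oBP; subst PB.
move=> hh'.
have -> // : h' = h by exact: algebra_hom_eq.
Qed.

End AlgebraEq.

Section SemialgebraEq.
Variable M : monad.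

Lemma semialgebra_eq (X : semialgebra M) (s : M X -> X) sP :
  s = @sastr M X -> @Semialgebra M X s sP = X.
Proof.
move=> sE; subst s; case: X sP => X s sP sP' /=.
by congr Semialgebra; exact: Prop_irrelevance.
Qed.

Lemma semialgebra_hom_sigT_eq (X Y : semialgebra M) sX PX sY PY
    (h : semialgebra_hom X Y)
    (h' : semialgebra_hom (@Semialgebra M X sX PX) (@Semialgebra M Y sY PY)) :
  sX = @sastr M X -> sY = @sastr M Y -> (h' : X -> Y) =1 h ->
  existT (fun XY : semialgebra M * semialgebra M => semialgebra_hom XY.1 XY.2)
    (@Semialgebra M X sX PX, @Semialgebra M Y sY PY) h' = existT _ (X, Y) h.
Proof.
move=> EX EY; subst sX sY; case: X Y PX PY h h' => X oX oXP [Y oY oYP] /=.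
move=> PX PY h h'.
have EX := Prop_irrelevance PX oXP; subst PX.
have EY := Prop_irrelevance PY oYP; subst PY.
move=> hh'.
have -> // : h' = h by exact: semialgebra_hom_eq.
Qed.

End SemialgebraEq.

(** * Binary mixtures of distributions *)

Section Mix.
Variable R : realType.
Local Notation dist := (dist R).
Local Notation open_unit := (open_unit R).

Lemma ou_eq (p q : open_unit) : p = q :> R -> p = q.
Proof.
case: p q => [p pP] [q qP] /= pq; subst q.
by congr OpenUnit; exact: Prop_irrelevance.
Qed.

Section MixDef.
Variables (X : Type) (p : open_unit) (phi psi : dist X).

Definition mix_pmf (x : X) : R := ouval p * phi x + (1 - ouval p) * psi x.

Lemma mix_itv x : 0 <= mix_pmf x <= 1.
Proof.
have /andP[p0 p1] := ouvalP p.
have /andP[h0 h1] := pmf_itv phi x; have /andP[s0 s1] := pmf_itv psi x.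
rewrite /mix_pmf; apply/andP; split; nra.
Qed.

Lemma supp_mix : supp mix_pmf `<=` supp phi `|` supp psi.
Proof.
move=> x /=; rewrite /supp /= /mix_pmf.
case: (eqVneq (phi x) 0) => [->|]; last by left.
case: (eqVneq (psi x) 0) => [->|]; last by right.
by rewrite !mulr0 addr0 eqxx.
Qed.

Lemma mix_fin : finite_set (supp mix_pmf).
Proof.
by apply: sub_finite_set supp_mix _; rewrite finite_setU; split; exact: pmf_fin.
Qed.

Lemma expect_mix (g : X -> R) :
  expect mix_pmf g = ouval p * expect phi g + (1 - ouval p) * expect psi g.
Proof.
pose U := supp phi `|` supp psi.
have fU : finite_set U by rewrite finite_setU; split; exact: pmf_fin.
rewrite !(expect_fset _ fU); [|by right|by left|exact: supp_mix].
rewrite !mulr_sumr -big_split /=; apply: eq_bigr => x _.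
by rewrite /mix_pmf mulrDl !mulrA.
Qed.

Lemma mix_sum : \sum_(x \in supp mix_pmf) mix_pmf x = 1.
Proof. by rewrite expect1 expect_mix -!expect1 !pmf_sum; ring. Qed.

Definition mix : dist X := Dist mix_itv mix_fin mix_sum.

End MixDef.

Lemma dmap_ddirac (X Y : Type) (f : X -> Y) x :
  dmap f (ddirac R x) = ddirac R (f x).
Proof. exact: (munit_nat (distribution_monad R)). Qed.

Lemma dmul_ddirac (X : Type) (phi : dist X) : dmul (ddirac R phi) = phi.
Proof. exact: (mmul_unit (m := distribution_monad R)). Qed.

Lemma dmap_mix (X Y : Type) (f : X -> Y) p (phi psi : dist X) :
  dmap f (mix p phi psi) = mix p (dmap f phi) (dmap f psi).
Proof.
by apply: dist_expect_eq => g; rewrite expect_dmap !expect_mix !expect_dmap.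
Qed.

Lemma dmul_mix (X : Type) p (Phi Psi : dist (dist X)) :
  dmul (mix p Phi Psi) = mix p (dmul Phi) (dmul Psi).
Proof.
by apply: dist_expect_eq => g; rewrite expect_dmul !expect_mix !expect_dmul.
Qed.

Lemma mix_idem (X : Type) p (phi : dist X) : mix p phi phi = phi.
Proof. by apply: dist_expect_eq => g; rewrite expect_mix; ring. Qed.

Lemma mix_comm (X : Type) p (phi psi : dist X) :
  mix p phi psi = mix (ou_onem p) psi phi.
Proof. by apply: dist_expect_eq => g; rewrite !expect_mix /=; ring. Qed.

Lemma mix_assoc (X : Type) p q (phi psi chi : dist X) :
  mix p (mix q phi psi) chi =
  mix (ou_mul p q) phi (mix (ou_assoc p q) psi chi).
Proof.
apply: dist_expect_eq => g; rewrite !expect_mix /=.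
have : 1 - ouval p * ouval q != 0.
  by rewrite subr_eq0 eq_sym lt_eqF // (ou_lt1 (ou_mul p q)).
by move=> ?; field.
Qed.

Lemma dist_supp_ex (X : Type) (phi : dist X) : exists x, phi x != 0.
Proof.
apply: contrapT => /forallNP phi0; have := pmf_sum phi.
rewrite fsbig1 => [/eqP|x /phi0//]; by rewrite eq_sym oner_eq0.
Qed.

(** The other values are nonnegative and sum to 0, hence vanish. *)
Lemma dist_eq1 (X : Type) (phi : dist X) x : phi x = 1 -> phi = ddirac R x.
Proof.
move=> phix; apply: dist_eq => y /=; rewrite /dirac_pmf.
case: asboolP => [->//|yx].
have fs := pmf_fin phi.
have := pmf_sum phi; rewrite fsbig_finite //=.
have xs : (x : {classic X}) \in fset_set (supp phi).
  by rewrite in_fset_set // inE /supp /= phix oner_neq0.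
rewrite (bigD1_seq (x : {classic X}) xs (fset_uniq _)) /= phix.
rewrite -[RHS]addr0 => /addrI s0.
have [//|/eqP phiy] := eqVneq (phi y) 0.
have ys : (y : {classic X}) \in fset_set (supp phi).
  by rewrite in_fset_set // inE /supp /=; apply/eqP.
have : all (fun z : {classic X} => (z != x) ==> (phi z == 0))
    (fset_set (supp phi)).
  rewrite -psumr_eq0; first exact/eqP.
  by move=> z _; case/andP: (pmf_itv phi z).
move/allP/(_ _ ys)/implyP => H; apply/eqP; apply: H; exact/eqP.
Qed.

(** * Splitting off a point, and induction on mixtures *)

Section Remove.
Variables (X : Type) (phi : dist X) (x : X).
Hypothesis phix : phi x < 1.

(** [phi] conditioned on the complement of [x]. *)
Definition rem_pmf (y : X) : R :=
  if `[< y = x >] then 0 else phi y / (1 - phi x).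

Lemma supp_rem : supp rem_pmf = supp phi `\ (x : {classic X}).
Proof.
apply/seteqP; split => y; rewrite /supp /rem_pmf /=.
  case: asboolP => [_|yx py]; first by rewrite eqxx.
  by split=> //; apply: contra_neq py => ->; rewrite mul0r.
move=> [py yx]; rewrite asboolF // mulf_neq0 // invr_eq0.
by rewrite subr_eq0 gt_eqF.
Qed.

Lemma rem_fin : finite_set (supp rem_pmf).
Proof. by rewrite supp_rem; apply: finite_setD; exact: pmf_fin. Qed.

Lemma expect_rem g :
  expect rem_pmf g = (expect phi g - phi x * g x) / (1 - phi x).
Proof.
(* Adjoining [x] lets its term be split off even when [phi x = 0]. *)
pose U : set {classic X} := supp phi `|` [set x : {classic X}].
have fU : finite_set U.
  by rewrite finite_setU; split; [exact: pmf_fin|exact: finite_set1].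
rewrite !(expect_fset _ fU); [|by left|by move=> y; rewrite supp_rem => -[]; left].
have xU : (x : {classic X}) \in fset_set U.
  by rewrite in_fset_set //; apply/mem_set; right.
rewrite !(bigD1_seq (x : {classic X}) xU (fset_uniq _)) /=.
rewrite {1}/rem_pmf asboolT // mul0r add0r addrC addrK mulr_suml.
apply: eq_bigr => y /eqP yx; rewrite /rem_pmf asboolF //; ring.
Qed.

Lemma rem_sum : \sum_(y \in supp rem_pmf) rem_pmf y = 1.
Proof.
rewrite expect1 expect_rem -expect1 pmf_sum mulr1 divff //.
by rewrite subr_eq0 gt_eqF.
Qed.

Lemma rem_itv y : 0 <= rem_pmf y <= 1.
Proof.
have r0 z : 0 <= rem_pmf z.
  rewrite /rem_pmf; case: asboolP => // _; apply: divr_ge0.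
    by case/andP: (pmf_itv phi z).
  by rewrite subr_ge0 ltW.
rewrite r0 -rem_sum fsbig_finite /=; last exact: rem_fin.
have [->|ry] := eqVneq (rem_pmf y) 0; first exact: sumr_ge0.
have ys : (y : {classic X}) \in fset_set (supp rem_pmf).
  by rewrite in_fset_set; [rewrite inE|exact: rem_fin].
rewrite (bigD1_seq (y : {classic X}) ys (fset_uniq _)) /= lerDl.
exact: sumr_ge0.
Qed.

Definition drem : dist X := Dist rem_itv rem_fin rem_sum.

Lemma mix_drem (p : open_unit) : ouval p = phi x ->
  phi = mix p (ddirac R x) drem.
Proof.
move=> pE; apply: dist_expect_eq => g.
rewrite expect_mix expect_dirac expect_rem pE.
have : 1 - phi x != 0 by rewrite subr_eq0 gt_eqF.
by move=> ?; field.
Qed.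

End Remove.

(** Induction on the size of the support: unless [phi] is Dirac, a support point [x] splits off with
    weight [phi x], and the conditioned remainder has one support point fewer. *)
Lemma dist_mix_ind (X : Type) (P : dist X -> Prop) :
  (forall x, P (ddirac R x)) ->
  (forall p phi psi, P phi -> P psi -> P (mix p phi psi)) ->
  forall phi, P phi.
Proof.
move=> P1 Pmix phi.
have [n] := ubnP #|` fset_set (supp phi)|; elim: n phi => // n IH phi phin.
have [x phix] := dist_supp_ex phi; have /andP[phi0 phi1] := pmf_itv phi x.
move: phi1; rewrite le_eqVlt => /orP[/eqP phi1|phi1].
  by rewrite (dist_eq1 phi1).
have pP : 0 < phi x < 1 by rewrite phi1 lt0r phix phi0.
rewrite (@mix_drem _ phi x phi1 (OpenUnit pP) erefl).
apply: Pmix; [exact: P1|apply: IH].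
rewrite /drem /= supp_rem // fset_setD1; last exact: pmf_fin.
rewrite -ltnS; apply: leq_trans phin; rewrite ltnS.
rewrite [ltnRHS](cardfsD1 (x : {classic X})).
by rewrite in_fset_set ?mem_set //; exact: pmf_fin.
Qed.

End Mix.

(** * From semialgebras to algebras *)

Section SemialgebraToAlgebra.
Variable R : realType.
Local Notation D := (distribution_monad R).
Local Notation T := (convex_semitheory R).

Section Ops.
Variable X : semialgebra D.

Definition sa_a (x : X) : X := sastr (ddirac R x : D X).

Definition sa_plus p (x y : X) : X :=
  sastr (mix p (ddirac R x) (ddirac R y) : D X).

(** This is the semialgebra law at the mixture of the Dirac distributions at [phi] and [psi]. *)
Lemma sastr_mix p (phi psi : dist R X) :
  sastr (mix p phi psi : D X) = sa_plus p (sastr (phi : D X)) (sastr (psi : D X)).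
Proof.
have := sastrP (mix p (ddirac R phi) (ddirac R psi) : D (D X)).
rewrite /= dmap_mix !dmap_ddirac dmul_mix !dmul_ddirac.
by move=> <-.
Qed.

Lemma sa_a_sastr (phi : dist R X) : sa_a (sastr (phi : D X)) = sastr (phi : D X).
Proof.
by have := sastrP (ddirac R phi : D (D X)); rewrite /= dmap_ddirac dmul_ddirac.
Qed.

Lemma sa_plus_a p (x y : X) : sa_plus p (sa_a x) (sa_a y) = sa_plus p x y.
Proof. by rewrite -sastr_mix. Qed.

Lemma sa_plus_assoc p q (x y z : X) : sa_plus p (sa_plus q x y) z =
  sa_plus (ou_mul p q) x (sa_plus (ou_assoc p q) y z).
Proof.
(* Replacing [z] by [sa_a z] makes both arguments of the outer operation values of [sastr], so that
   [mix_assoc] can be used. *)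
rewrite -sa_plus_a sa_a_sastr /sa_a -[LHS]sastr_mix mix_assoc sastr_mix sastr_mix.
by rewrite -[RHS]sa_plus_a sa_a_sastr sa_plus_a.
Qed.

Definition sa_op (f : opsym T) : ('I_(arity f) -> X) -> X :=
  match f as g return ('I_(@arity T g) -> X) -> X with
  | op_a => fun args => sa_a (args ord0)
  | op_plus p => fun args => sa_plus p (args ord0) (args ord_max)
  end.

Lemma sa_opP (s t : term T) : equations (s, t) ->
  forall v : nat -> X, eval sa_op v s = eval sa_op v t.
Proof.
move=> st v; have {}st : convex_eq s t := st.
case: s t / st => /= [|p|p|p|p|p q]; rewrite ?sa_a_sastr //.
- exact: sa_plus_a.
- by rewrite /sa_plus mix_idem.
- by rewrite /sa_plus mix_comm.
- exact: sa_plus_assoc.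
Qed.

Definition sa_algebra : algebra T := Algebra sa_opP.

End Ops.

Lemma sa_algebra_homP (X Y : semialgebra D) (h : semialgebra_hom X Y)
    (f : opsym T) (args : 'I_(arity f) -> sa_algebra X) :
  h (aop args) = @aop T (sa_algebra Y) f (h \o args).
Proof.
case: f args => [|p] args /=; rewrite sahomP /=.
  by rewrite dmap_ddirac.
by rewrite dmap_mix !dmap_ddirac.
Qed.

Definition sa_algebra_hom (X Y : semialgebra D) (h : semialgebra_hom X Y) :
  algebra_hom (sa_algebra X) (sa_algebra Y) :=
  @AlgebraHom T (sa_algebra X) (sa_algebra Y) h (sa_algebra_homP h).

Definition EMs_to_Alg : functor (EMs D) (Alg T).
Proof.
by apply: (@Functor (EMs D) (Alg T) sa_algebra sa_algebra_hom) => *;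
  exact: algebra_hom_eq.
Defined.

End SemialgebraToAlgebra.

(** * From algebras to semialgebras *)

Section AlgebraToSemialgebra.
Variable R : realType.
Local Notation D := (distribution_monad R).
Local Notation T := (convex_semitheory R).

Section Ops.
Variable A : algebra T.

Definition al_a (x : A) : A := @aop T A (op_a R) (fun=> x).

Definition al_plus p (x y : A) : A :=
  @aop T A (op_plus p) (fun i : 'I_2 => if i == ord0 then x else y).

Lemma eval_a v t : eval (@aop T A) v (tm_a t) = al_a (eval (@aop T A) v t).
Proof. by []. Qed.

Lemma eval_plus v p s t : eval (@aop T A) v (tm_plus p s t) =
  al_plus p (eval (@aop T A) v s) (eval (@aop T A) v t).
Proof.
rewrite /= /al_plus; congr (aop _); apply/funext => i.
by case: ifP.
Qed.

Definition vars (x y z : A) (n : nat) : A :=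
  match n with 0 => x | 1 => y | _ => z end.

Lemma convex_eq_eval s t : convex_eq s t ->
  forall v : nat -> A, eval (@aop T A) v s = eval (@aop T A) v t.
Proof. exact: (@aopP T A s t). Qed.

Lemma al_aa x : al_a (al_a x) = al_a x.
Proof. exact: (convex_eq_eval (eq_aa R) (vars x x x)). Qed.

Lemma al_a_plus p x y : al_a (al_plus p x y) = al_plus p x y.
Proof.
have := convex_eq_eval (eq_a_plus p) (vars x y y).
by rewrite eval_a !eval_plus.
Qed.

Lemma al_plus_a p x y : al_plus p (al_a x) (al_a y) = al_plus p x y.
Proof. by have := convex_eq_eval (eq_plus_a p) (vars x y y); rewrite !eval_plus. Qed.

Lemma al_plus_idem p x : al_plus p x x = al_a x.
Proof. by have := convex_eq_eval (eq_plus_idem p) (vars x x x); rewrite !eval_plus. Qed.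

Lemma al_plus_comm p x y : al_plus p x y = al_plus (ou_onem p) y x.
Proof. by have := convex_eq_eval (eq_plus_comm p) (vars x y y); rewrite !eval_plus. Qed.

Lemma al_plus_assoc p q x y z : al_plus p (al_plus q x y) z =
  al_plus (ou_mul p q) x (al_plus (ou_assoc p q) y z).
Proof. by have := convex_eq_eval (eq_plus_assoc p q) (vars x y z); rewrite !eval_plus. Qed.

(* [CPt b r0] is the point [b] with weight [r > 0]: adding weights and taking
   the barycentre of the points turns the convex operations into a commutative
   monoid, so that finite sums do not depend on an order of summation. *)
Inductive cone := CZero | CPt (r : R) (b : A) of 0 < r.

Lemma cpt_eq r s b c (r0 : 0 < r) (s0 : 0 < s) :
  r = s -> b = c -> CPt b r0 = CPt c s0.
Proof.
by move=> rs bc; subst s c; congr CPt; exact: Prop_irrelevance.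
Qed.

Lemma ratio_subproof (r s : R) : 0 < r -> 0 < s -> 0 < r / (r + s) < 1.
Proof.
move=> r0 s0; have rs := addr_gt0 r0 s0.
by rewrite divr_gt0 //= ltr_pdivrMr // mul1r ltrDl.
Qed.

Definition ratio r s (r0 : 0 < r) (s0 : 0 < s) : open_unit R :=
  OpenUnit (ratio_subproof r0 s0).

Definition cadd u v : cone :=
  match u, v with
  | CZero, _ => v
  | _, CZero => u
  | CPt r b r0, CPt s c s0 =>
      CPt (al_plus (ratio r0 s0) b c) (addr_gt0 r0 s0)
  end.

Lemma cadd0c : left_id CZero cadd. Proof. by []. Qed.

Lemma caddc0 : right_id CZero cadd. Proof. by case. Qed.

Lemma caddC : commutative cadd.
Proof.
case=> [|r b r0] [|s c s0] //=; apply: cpt_eq; first exact: addrC.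
rewrite al_plus_comm; congr al_plus; apply: ou_eq => /=.
have : r + s != 0 by rewrite gt_eqF // addr_gt0.
by rewrite [s + r]addrC => ?; field.
Qed.

Lemma caddA : associative cadd.
Proof.
case=> [|r b r0] [|s c s0] [|t d t0] //=; apply: cpt_eq; first exact: addrA.
have rs : r + s != 0 by rewrite gt_eqF // addr_gt0.
have st : s + t != 0 by rewrite gt_eqF // addr_gt0.
have rst : r + s + t != 0 by rewrite gt_eqF // !addr_gt0.
have rst' : r + (s + t) != 0 by rewrite addrA.
(* With [p = (r + s) / (r + s + t)] and [q = r / (r + s)], the indices of the associativity equation
   become [p q = r / (r + s + t)] and [p (1 - q) / (1 - p q) = s / (s + t)]. *)
rewrite al_plus_assoc; congr al_plus.
  by apply: ou_eq => /=; field; exact/andP.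
congr al_plus; apply: ou_eq => /=.
have -> : 1 - (r + s) / (r + s + t) * (r / (r + s)) = (s + t) / (r + s + t).
  by field; exact/andP.
by field; exact/and3P.
Qed.

HB.instance Definition _ := Monoid.isComLaw.Build cone CZero cadd
  caddA caddC cadd0c.

(** Total form of [CPt]: a weight 0, as at a point outside one of two supports, contributes nothing
    to a sum. *)
Definition cpt (r : R) (b : A) : cone :=
  if pselect (0 < r) is left r0 then CPt b r0 else CZero.

Lemma cptE r b (r0 : 0 < r) : cpt r b = CPt b r0.
Proof.
by rewrite /cpt; case: pselect => // r0'; exact: cpt_eq.
Qed.

Lemma cpt0 b : cpt 0 b = CZero.
Proof. by rewrite /cpt; case: pselect => // r0; have := r0; rewrite ltxx. Qed.

(** For positive weights, adding the two copies of [b] gives the point [b +_p b = a b], which is [b]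
    again by hypothesis. *)
Lemma cptD r s b : 0 <= r -> 0 <= s -> al_a b = b ->
  cpt (r + s) b = cadd (cpt r b) (cpt s b).
Proof.
rewrite le_eqVlt => /orP[/eqP <-|r0]; first by rewrite add0r cpt0.
rewrite le_eqVlt => /orP[/eqP <-|s0]; first by rewrite addr0 cpt0 caddc0.
move=> ab; rewrite !cptE ?addr_gt0 // => rs0 /=.
by apply: cpt_eq => //; rewrite al_plus_idem.
Qed.

Definition cscale (p : R) (u : cone) : cone :=
  if u is CPt r b _ then cpt (p * r) b else CZero.

Lemma cscale_cpt p r b : 0 < p -> 0 <= r -> cscale p (cpt r b) = cpt (p * r) b.
Proof.
move=> p0; rewrite le_eqVlt => /orP[/eqP <-|r0]; first by rewrite mulr0 !cpt0.
by rewrite cptE.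
Qed.

(** A common factor cancels in [ratio], so the barycentre does not move. *)
Lemma cscaleD p : 0 < p -> {morph cscale p : u v / cadd u v}.
Proof.
move=> p0 [|r b r0] [|s c s0] //=; first by rewrite caddc0.
have pr0 := mulr_gt0 p0 r0; have ps0 := mulr_gt0 p0 s0.
have prs0 := mulr_gt0 p0 (addr_gt0 r0 s0).
rewrite (cptE _ pr0) (cptE _ ps0) (cptE _ prs0) /=.
apply: cpt_eq; first exact: mulrDr.
congr al_plus; apply: ou_eq => /=.
have rs : r + s != 0 by rewrite gt_eqF // addr_gt0.
have p0' : p != 0 by rewrite gt_eqF.
rewrite -mulrDr; field; exact/andP.
Qed.

Definition cweight (u : cone) : R := if u is CPt r _ _ then r else 0.

Lemma cweightD : {morph cweight : u v / cadd u v >-> u + v}.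
Proof. by case=> [|r b r0] [|s c s0] /=; rewrite ?add0r ?addr0. Qed.

Lemma cweight_cpt r b : 0 <= r -> cweight (cpt r b) = r.
Proof.
rewrite le_eqVlt => /orP[/eqP <-|r0]; first by rewrite cpt0.
by rewrite cptE.
Qed.

(** The points are [al_a x] rather than [x] because [cptD] asks for points fixed by [al_a]. *)
Definition csum (phi : A -> R) : cone :=
  \big[cadd/CZero]_(x \in supp phi) cpt (phi x) (al_a x).

Lemma csum_fset (U : set {classic A}) (phi : A -> R) :
  finite_set U -> supp phi `<=` U ->
  csum phi = \big[cadd/CZero]_(x <- fset_set U) cpt (phi x) (al_a x).
Proof.
move=> fU pU; rewrite /csum -fsbig_finite //.
apply: fsbig_widen => // x [_] /= /negP.
by rewrite negbK => /eqP ->; rewrite cpt0.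
Qed.

Lemma cweight_csum (phi : dist R A) : cweight (csum phi) = 1.
Proof.
rewrite (csum_fset (pmf_fin phi)) // (big_morph _ cweightD (erefl : _ CZero = 0)).
rewrite -(pmf_sum phi) fsbig_finite; last exact: pmf_fin.
by apply: eq_bigr => x _; rewrite cweight_cpt //; case/andP: (pmf_itv phi x).
Qed.

Lemma csum_ex (phi : dist R A) : exists b, csum phi = cpt 1 b.
Proof.
have := cweight_csum phi; case: (csum phi) => [/= /eqP|r b r0 /= r1].
  by rewrite eq_sym oner_eq0.
by subst r; exists b; rewrite cptE.
Qed.

(** The choice is harmless: by [cpt_inj] the sum determines its point. *)
Definition al_str (phi : D A) : A := projT1 (cid (csum_ex phi)).

Lemma csum_al_str (phi : D A) : csum phi = cpt 1 (al_str phi).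
Proof. by rewrite /al_str; case: cid. Qed.

Lemma cpt_inj b c : cpt 1 b = cpt 1 c -> b = c.
Proof. by rewrite !(cptE _ ltr01) => -[]. Qed.

Lemma al_str_ddirac x : al_str (ddirac R x) = al_a x.
Proof.
apply: cpt_inj; rewrite -csum_al_str /csum /= supp_dirac fsbig_set1.
by rewrite /dirac_pmf asboolT.
Qed.

Lemma al_str_mix p (phi psi : D A) :
  al_str (mix p phi psi) = al_plus p (al_str phi) (al_str psi).
Proof.
apply: cpt_inj; rewrite -csum_al_str.
have p0 := ou_gt0 p; have q0 := ou_gt0 (ou_onem p); rewrite /= in q0.
(* Over the union of the supports, [cptD] splits the weight [p phi x + (1 - p) psi x] of each
   [al_a x], and additivity of [cscale] regroups the two halves. *)
transitivity (cadd (cscale (ouval p) (csum phi)) (cscale (1 - ouval p) (csum psi))).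
  pose U := supp phi `|` supp psi.
  have fU : finite_set U by rewrite finite_setU; split; exact: pmf_fin.
  rewrite !(csum_fset fU); [|by right|by left|exact: supp_mix].
  rewrite !(big_morph _ (cscaleD _) (erefl : cscale _ CZero = CZero)) //.
  rewrite -big_split; apply: eq_bigr => x _ /=.
  have /andP[h0 _] := pmf_itv phi x; have /andP[s0 _] := pmf_itv psi x.
  by rewrite !cscale_cpt // -cptD ?al_aa // mulr_ge0 // ltW.
rewrite !csum_al_str !(cptE _ ltr01) /= !mulr1 (cptE _ p0) (cptE _ q0) /=.
apply: cpt_eq; first by rewrite addrC subrK.
(* The weights [p] and [1 - p] add up to 1, so their [ratio] is [p] itself. *)
by congr al_plus; apply: ou_eq => /=; rewrite addrC subrK divr1.
Qed.

(** What the Dirac case of [al_strP] asks for, where [al_a] appears in place of a unit law. *)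
Lemma al_a_str (phi : D A) : al_a (al_str phi) = al_str phi.
Proof.
by elim/(@dist_mix_ind R): phi => [x|p phi psi _ _];
  rewrite ?al_str_ddirac ?al_aa // al_str_mix al_a_plus.
Qed.

Lemma al_strP (Phi : D (D A)) : al_str (mmap al_str Phi) = al_str (mmul Phi).
Proof.
elim/(@dist_mix_ind R): Phi => [phi|p Phi Psi IHPhi IHPsi] /=.
  by rewrite dmap_ddirac dmul_ddirac al_str_ddirac al_a_str.
by rewrite dmap_mix dmul_mix !al_str_mix IHPhi IHPsi.
Qed.

Definition al_semialgebra : semialgebra D := Semialgebra al_strP.

End Ops.

(** * Functoriality and the two round trips *)

Lemma al_a_hom (A B : algebra T) (h : algebra_hom A B) x :
  h (al_a x) = al_a (h x).
Proof. by rewrite /al_a ahomP. Qed.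

Lemma al_plus_hom (A B : algebra T) (h : algebra_hom A B) p x y :
  h (al_plus p x y) = al_plus p (h x) (h y).
Proof.
rewrite /al_plus ahomP; congr (aop _); apply/funext => i /=.
by case: ifP.
Qed.

Lemma al_semialgebra_homP (A B : algebra T) (h : algebra_hom A B)
    (phi : D (al_semialgebra A)) :
  h (sastr phi) = @sastr D (al_semialgebra B) (mmap h phi).
Proof.
elim/(@dist_mix_ind R): phi => [x|p phi psi IHphi IHpsi] /=.
  by rewrite dmap_ddirac !al_str_ddirac al_a_hom.
by rewrite dmap_mix !al_str_mix al_plus_hom IHphi IHpsi.
Qed.

Definition al_semialgebra_hom (A B : algebra T) (h : algebra_hom A B) :
  semialgebra_hom (al_semialgebra A) (al_semialgebra B) :=
  @SemialgebraHom D (al_semialgebra A) (al_semialgebra B) h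
    (al_semialgebra_homP h).

Definition Alg_to_EMs : functor (Alg T) (EMs D).
Proof.
by apply: (@Functor (Alg T) (EMs D) al_semialgebra al_semialgebra_hom) => *;
  exact: semialgebra_hom_eq.
Defined.

Lemma sa_op_al_str (A : algebra T) : @sa_op R (al_semialgebra A) = @aop T A.
Proof.
apply: functional_extensionality_dep => -[|p]; apply/funext => args /=.
  rewrite /sa_a /= al_str_ddirac; congr (aop _); apply/funext => i.
  by congr args; rewrite [RHS]ord1.
(* The equation [a x +_p a y = x +_p y] removes the [al_a] brought in by the Dirac distributions; it
   remains to recover [args] from its values at the two indices. *)
rewrite /sa_plus /= al_str_mix !al_str_ddirac al_plus_a.
congr (aop _); apply/funext => i; case: eqP => [->//|].
case: i => -[|[|//]] i2 i0; first by case: i0; exact: val_inj.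
by congr args; exact: val_inj.
Qed.

(** Both structures agree on Dirac distributions and send mixtures to the same operation, so
    induction on mixtures identifies them. *)
Lemma al_str_sa_op (X : semialgebra D) : @al_str (sa_algebra X) = @sastr D X.
Proof.
apply/funext; elim/(@dist_mix_ind R) => [x|p phi psi IHphi IHpsi].
  by rewrite al_str_ddirac.
by rewrite al_str_mix IHphi IHpsi sastr_mix.
Qed.

End AlgebraToSemialgebra.

Theorem theorem5p3 (R : realType) :
  isomorphic (Alg (convex_semitheory R)) (EMs (distribution_monad R)).
Proof.
exists (Alg_to_EMs R), (EMs_to_Alg R); split; apply: functor_eq_id.
- by move=> A; apply: algebra_eq; exact: sa_op_al_str.
- move=> A B f; exact: algebra_hom_sigT_eq (sa_op_al_str A) (sa_op_al_str B) _.
- by move=> X; apply: semialgebra_eq; exact: al_str_sa_op.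
- move=> X Y f.
  exact: semialgebra_hom_sigT_eq (al_str_sa_op X) (al_str_sa_op Y) _.
Qed.
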